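(* Let $V = V_1 \oplus \dots \oplus V_{n_t}$ be a vector space over $\mathrm{GF}(2)$, where each $V_i$ is a subspace of the same finite dimension $m$. For each $i$ let $\gamma_i$ be a permutation of $V_i$, and let $\gamma$ be the permutation of $V$ given by $(v_1 + \dots + v_{n_t})\gamma = v_1\gamma_1 + \dots + v_{n_t}\gamma_{n_t}$ for $v_i \in V_i$. Let $\lambda$ be an invertible linear map $V \to V$, let $\rho = \gamma\lambda$, and let $G = \langle\, \rho\sigma_k : k \in V\,\rangle \le \mathrm{Sym}(V)$. Suppose the following hold: (1) $0\gamma = 0$ and $\gamma^2 = 1$, the identity transformation. (2) There is an integer $r$ with $1 \le r < m/2$ such that for all $i$: - for all $0 \ne v \in V_i$, the image of the map $V_i \to V_i$, $x \mapsto (x+v)\gamma_i + x\gamma_i$, has size greater than $2^{m-r-1}$; and - there is no proper subspace of $V_i$, invariant under $\gamma_i$, of codimension (in $V_i$) less than or equal to $2r$. (3) No sum of some of the $V_i$ (except $\{0\}$ and $V$) is invariant under $\lambda$. Then $G$ is primitive in its action on $V$.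
   Context: Maps are written on the right and composed left to right: $v\rho = (v\gamma)\lambda$. For $k \in V$, $\sigma_k : V \to V$ is the translation $w \mapsto w + k$. The permutations $\rho\sigma_k$ are the round functions of a key-alternating block cipher ($\gamma$ is the bricklayer transformation with S-boxes $\gamma_i$, and $\lambda$ is the linear mixing layer), and $G$ is the group they generate (it contains all translations, hence is transitive on $V$). A partition $\mathcal{B}$ of $V$ is $G$-invariant if $Bg \in \mathcal{B}$ for all $B \in \mathcal{B}$, $g \in G$; it is trivial if $\mathcal{B} = \{V\}$ or $\mathcal{B} = \{\{\alpha\} : \alpha \in V\}$. $G$ is primitive if the only $G$-invariant partitions of $V$ are the trivial ones. A subset $S$ is invariant under a map $f$ if $Sf \subseteq S$. *)

(* Defs.v *)
From HB Require Import structures.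
From mathcomp Require Export all_boot all_order all_algebra.
From mathcomp Require Export all_fingroup all_solvable all_field.

Set Implicit Arguments.
Unset Strict Implicit.
Unset Printing Implicit Defensive.

Import GRing.Theory.
Local Open Scope ring_scope.

(* [finvect_type vT] is [vT] itself, with its canonical finType instance, so   *)
(* that {perm _} and the finite-set library apply to it.  Products in the      *)
(* group {perm V} compose left to right: (s * t)%g x = t (s x).                *)

Section Space.
Variable vT : vectType 'F_2.
Notation V := (finvect_type vT).

Definition internal_sum n (Vs : 'I_n -> {vspace V}) : Prop :=
  (\sum_i Vs i)%VS = fullv /\ directv (\sum_i Vs i).

Definition vspace_invariant (f : V -> V) (U : {vspace V}) : Prop :=
  {in U, forall v, f v \in U}.

Definition translation (k : V) : {perm V} := perm (@addIr V k).

Definition round_group (rho : {perm V}) : {group {perm V}} :=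
  <<[set (rho * translation k)%g | k : V]>>%G.

End Space.

Notation summand Vs i := (finvect_type (subvs_of (Vs i))).

Definition bricklayer (vT : vectType 'F_2) n
    (Vs : 'I_n -> {vspace finvect_type vT})
    (gam : forall i, {perm summand Vs i})
    (gamma : {perm finvect_type vT}) : Prop :=
  forall v : (forall i, summand Vs i),
    gamma (\sum_i vsval (v i)) = \sum_i vsval (gam i (v i)).

Definition diff_image (vT : vectType 'F_2) (f : {perm finvect_type vT})
    (v : finvect_type vT) : {set finvect_type vT} :=
  [set f (x + v) + f x | x : finvect_type vT].

(* Main.v *)
Require Import Defs.
From mathcomp Require Import zify.

(** If [G] is imprimitive, then, as [G] contains the translations, the block
    of 0 is a subspace [U], neither 0 nor the whole space, and
    [rho (v + u) - rho v] lies in [U] for all [v] and all [u] in [U], where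
    [rho := gamma * lam] ([imprimitivity_subspace]).  Put [W := lam^-1 U].
    By linearity of [lam] the derivatives of [gamma] in the directions of [U]
    take values in [W]; since [gamma] fixes 0 and [U] and [W] have the same
    size, [gamma] maps [U] onto [W], and being an involution it exchanges them.

    Suppose that every nonzero component of a vector of [U] belongs to a
    summand contained in [U].  Then [U] is a sum of summands
    ([sum_of_contained_summands]), so it is invariant under [gamma]; hence
    [W = U] and [U] is invariant under [lam], against the third hypothesis.

    Otherwise some [u] in [U] has a nonzero component [d] on a summand [Vs i]
    not contained in [U].  Letting the argument vary in [Vs i] only, the
    derivative of [gamma] along [u] reproduces, up to a constant, that of
    [gam i] along [d], so [W :&: Vs i] has more than [2 ^ (m - r - 1)]
    elements ([card_diff_image_le]) and codimension at most [r] in [Vs i].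
    The same holds for its mirror image [U :&: Vs i].  The intersection of
    the two is a proper subspace of [Vs i] of codimension at most [2r],
    invariant under [gam i] ([exchanged_vspace_trace]), against the second
    hypothesis. *)

Set Implicit Arguments.
Unset Strict Implicit.
Unset Printing Implicit Defensive.

Import GRing.Theory.
Local Open Scope ring_scope.

(** * Block systems of groups containing the translations *)

Section BinarySpaces.
Variable vT : vectType 'F_2.
Notation V := (finvect_type vT).

Lemma addvv_F2 (x : V) : x + x = 0.
Proof.
rewrite -mulr2n -(scaler_nat 2 x).
have -> : (2%:R : 'F_2) = 0 by apply/val_inj.
by rewrite scale0r.
Qed.

Lemma oppv_F2 (x : V) : - x = x.
Proof. by apply/esym/eqP; rewrite -addr_eq0 addvv_F2. Qed.

(** Scalars of GF(2) are 0 and 1, so closure under addition already gives a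
    linear subspace. *)
Lemma add_closed_vspace (A : {set V}) :
    0 \in A -> {in A &, forall x y, x + y \in A} ->
  {U : {vspace V} | forall v, (v \in U) = (v \in A)}.
Proof.
move=> A0 AD; exists <<enum A>>%VS => v.
apply/idP/idP => [|Av]; last by apply: memv_span; rewrite mem_enum.
move=> /(@coord_span _ _ _ (in_tuple (enum A))) ->.
apply: (big_ind (fun x => x \in A)) => // i _.
have Ai: (in_tuple (enum A))`_i \in A by rewrite -mem_enum mem_nth.
rewrite -(natr_Zp (coord _ _ _)) scaler_nat.
by elim: (X in _ *+ X) => [|n IHn]; rewrite ?mulr0n // mulrS AD.
Qed.

Lemma translationE (k x : V) : translation k x = x + k.
Proof. by rewrite permE. Qed.

Lemma mem_round_group (rho : {perm V}) : rho \in round_group rho.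
Proof.
apply: mem_gen; apply/imsetP; exists 0 => //.
by apply/permP => x; rewrite permM translationE addr0.
Qed.

Lemma translation_round_group (rho : {perm V}) k :
  translation k \in round_group rho.
Proof.
rewrite -[translation k](mulKg rho) groupM ?groupV ?mem_round_group //.
by apply: mem_gen; apply/imsetP; exists k.
Qed.

(** The translations are transitive and act on any block system; the block of
    0 absorbs its own translations, hence is a subspace, and all blocks are
    its cosets.  A permutation preserving the blocks therefore sends elements
    differing by a vector of this subspace to such elements. *)
Lemma imprimitivity_subspace (rho : {perm V}) :
    ~~ [primitive round_group rho, on [set: V] | 'P] ->
  exists U : {vspace V}, [/\ U <> 0%VS, U <> fullv &
    forall v, {in U, forall u, rho (v + u) - rho v \in U}].
Proof.
pose G := round_group rho; rewrite /primitive.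
have -> /=: [transitive G, on [set: V] | 'P].
  apply/imsetP; exists 0 => //; apply/setP => x; rewrite inE; apply/esym.
  apply/orbitP; exists (translation x); first exact: translation_round_group.
  by rewrite /= apermE translationE add0r.
rewrite negbK => /existsP[Q /and3P[/and3P[/eqP covQ tiQ Q0] actQ cardQ]].
have inQ x : pblock Q x \in Q by rewrite pblock_mem // covQ.
have mem_blk x : x \in pblock Q x by rewrite mem_pblock covQ.
have actG g x y : g \in G -> y \in pblock Q x -> g y \in pblock Q (g x).
  move=> Gg xy.
  have Qg: (('P)^*)%act (pblock Q x) g \in Q by rewrite (actsP actQ).
  have gblk z : z \in pblock Q x -> g z \in (('P)^*)%act (pblock Q x) g.
    by move=> xz; apply/imsetP; exists z.
  by rewrite (def_pblock tiQ Qg) gblk.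
have shift k x y : y \in pblock Q x -> y + k \in pblock Q (x + k).
  rewrite -!translationE; apply: actG; exact: translation_round_group.
have [|x y|U memU] := @add_closed_vspace (pblock Q 0); first exact: mem_blk.
  move=> Ux Uy; have := shift y _ _ Ux; rewrite add0r.
  by rewrite (same_pblock tiQ Uy).
have memB x y : (y \in pblock Q x) = (y - x \in U).
  rewrite memU; apply/idP/idP => [/(shift (- x)) | /(shift x)].
    by rewrite subrr.
  by rewrite add0r subrK.
exists U; split=> [U0 | Uf | v u Uu].
- move: cardQ; rewrite ltnNge [X in _ && X]ltnNge.
  have -> : (#|[set: V]| <= #|Q|)%N; last by rewrite andbF.
  have blk_inj : injective (pblock Q).
    move=> x y Exy; have := mem_blk y; rewrite -Exy memB U0 memv0 subr_eq0.
    by move/eqP.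
  rewrite -(card_imset [set: V] blk_inj) subset_leq_card //.
  by apply/subsetP => _ /imsetP[x _ ->].
- move: cardQ; rewrite ltnNge.
  have -> //: (#|Q| <= 1)%N.
  have: Q \subset [set pblock Q 0].
    apply/subsetP => B QB; rewrite inE.
    have [B0|/set0Pn[x Bx]] := eqVneq B set0.
      by rewrite B0 (negbTE Q0) in QB.
    rewrite -(def_pblock tiQ QB Bx); apply/eqP/same_pblock => //.
    by rewrite memB Uf memvf.
  by move/subset_leq_card; rewrite cards1.
rewrite -memB; apply: actG; first exact: mem_round_group.
by rewrite memB addrC addKr.
Qed.

End BinarySpaces.

(** * Bricklayer permutations and their traces on the summands *)

Section Bricklayer.
Variables (vT : vectType 'F_2) (nt : nat).
Notation V := (finvect_type vT).
Variables (Vs : 'I_nt -> {vspace V}).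
Variables (gam : forall i, {perm summand Vs i}) (gamma : {perm V}).
Hypothesis hV : internal_sum Vs.
Hypothesis hgamma : bricklayer gam gamma.
Hypothesis gamma0 : gamma 0 = 0.

Lemma internal_sum_components (v : V) :
  exists c : forall i, summand Vs i, v = \sum_i vsval (c i).
Proof.
have: v \in (\sum_i Vs i)%VS by rewrite hV.1 memvf.
case/memv_sumP => vs memvs ->.
exists (fun i => vsproj (Vs i) (vs i)); apply: eq_bigr => i _.
by rewrite vsprojK // memvs.
Qed.

Lemma sum_dfwith0 i (d : summand Vs i) (F : forall j, summand Vs j -> V) :
    (forall j, F j 0 = 0) ->
  \sum_j F j (dfwith (T := fun j => summand Vs j) (fun=> 0) d j) = F i d.
Proof.
move=> F0; rewrite (bigD1 i) //= dfwith_in big1 ?addr0 // => j ji.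
by rewrite dfwith_out 1?eq_sym.
Qed.

Lemma bricklayer_component0 i : gam i 0 = 0.
Proof.
(* The [gam i 0] sum to [gamma 0 = 0], and the sum of the [Vs i] is direct. *)
have := hgamma (fun=> 0); rewrite big1 ?gamma0 // => /esym sum0.
apply: val_inj => /=.
have /directv_sum_independent/(_ (fun i => vsval (gam i 0))) := hV.2.
by apply=> // j _; apply: subvsP.
Qed.

Lemma bricklayer_summand i (x : summand Vs i) :
  gamma (vsval x) = vsval (gam i x).
Proof.
have := hgamma (dfwith (T := fun j => summand Vs j) (fun=> 0) x).
rewrite (sum_dfwith0 _ (F := fun j y => vsval y)) //.
rewrite (sum_dfwith0 _ (F := fun j y => vsval (gam j y))) // => j.
by rewrite bricklayer_component0.
Qed.

(** In the difference on the left all components but the [i]-th cancel, so a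
    derivative of [gamma] in an arbitrary direction, read on [Vs i], becomes a
    statement about [gam i] alone. *)
Lemma bricklayer_shift (c : forall i, summand Vs i) i (x : summand Vs i) :
  gamma (vsval x + \sum_j vsval (c j)) - gamma (\sum_j vsval (c j)) =
  vsval (gam i (x + c i)) - vsval (gam i (c i)).
Proof.
have -> : vsval x + \sum_j vsval (c j) = \sum_j vsval (dfwith c (x + c i) j).
  rewrite (bigD1 i) //= [RHS](bigD1 i) //= dfwith_in addrA; congr (_ + _).
  by apply: eq_bigr => j ji; rewrite dfwith_out 1?eq_sym.
rewrite !hgamma (bigD1 i) //= [X in _ - X](bigD1 i) //= dfwith_in.
rewrite (eq_bigr (fun j => vsval (gam j (c j)))) => [|j ji].
  by rewrite opprD addrACA subrr addr0.
by rewrite dfwith_out 1?eq_sym.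
Qed.

(** The criterion under which the hypothesis on sums of summands applies to a
    block: each vector of [U] is the sum of its components, and each of these
    is 0 or lies in a summand contained in [U]. *)
Lemma sum_of_contained_summands (U : {vspace V}) :
    (forall c : forall i, summand Vs i, \sum_i vsval (c i) \in U ->
     forall i, c i != 0 -> (Vs i <= U)%VS) ->
  U = (\sum_(i in [set i | Vs i <= U]) Vs i)%VS.
Proof.
move=> UVs; apply/eqP; rewrite eqEsubv; apply/andP; split; last first.
  by apply/subv_sumP => i; rewrite inE.
apply/subvP => u; have [c ->] := internal_sum_components u => Uc.
apply: memv_suml => i _; have [->|ci0] := eqVneq (c i) 0; first exact: mem0v.
have Ji: i \in [set i | Vs i <= U]%VS by rewrite inE (UVs c).
by apply: (subvP (sumv_sup i Ji (subvv _))); apply: subvsP.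
Qed.

Lemma bricklayer_sum_invariant (J : {set 'I_nt}) :
  vspace_invariant gamma (\sum_(i in J) Vs i)%VS.
Proof.
move=> _ /memv_sumP[vs memvs ->].
have [c memc]: exists c : forall i, summand Vs i,
    forall i, vsval (c i) = if i \in J then vs i else 0.
  exists (fun i => vsproj (Vs i) (if i \in J then vs i else 0)) => i.
  by rewrite vsprojK //; case: ifP => [/memvs|_] //; exact: mem0v.
rewrite big_mkcond -(eq_bigr _ (fun i _ => memc i)) hgamma.
apply: memv_suml => i _; case Ji: (i \in J).
  by apply: (subvP (sumv_sup i Ji (subvv _))); apply: subvsP.
have ->: c i = 0 by apply: val_inj; rewrite /= memc Ji.
by rewrite bricklayer_component0; apply: mem0v.
Qed.

(** This turns many values of one derivative of [gam i] into a large
    [W :&: Vs i].  If [u] has component [d] on [Vs i], then for [x] in [Vs i]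
    the value at [x] of the derivative of [gamma] in direction [u], corrected
    by [gamma u], lies in [Vs i] and equals that of [gam i] in direction [d],
    corrected by [gam i d]; distinct derivative values give distinct
    vectors. *)
Lemma card_diff_image_le (U W : {vspace V}) (c : forall i, summand Vs i) i :
    (forall v, {in U, forall u, gamma (v + u) - gamma v \in W}) ->
    \sum_j vsval (c j) \in U ->
  (#|diff_image (gam i) (c i)| <= 2 ^ \dim (W :&: Vs i))%N.
Proof.
set u := \sum_j _ => UW Uu.
have := card_vspace (W :&: Vs i)%VS; rewrite card_Fp // => <-.
pose f (y : summand Vs i) : V := vsval y - vsval (gam i (c i)).
have f_inj: injective f by move=> x y /addIr/subvs_inj.
rewrite -(card_imset _ f_inj) subset_leq_card //.
apply/subsetP => _ /imsetP[_ /imsetP[x _ ->] ->]; rewrite /f /=.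
rewrite memv_cap; apply/andP; split; last by rewrite memvB ?memvD ?subvsP.
(* Subtracting the derivative at 0, which is [gamma u], removes the components
   outside [Vs i]. *)
have:= rpredB (UW (vsval x) u Uu) (UW 0 u Uu).
rewrite gamma0 add0r subr0 addrAC bricklayer_shift bricklayer_summand.
by rewrite (oppv_F2 (vsval (gam i x))) addrAC.
Qed.

(** [gam i] acts on the type of the summand while dimensions are compared in
    [V]; this transports [U :&: Vs i] from the latter to the former. *)
Lemma vspace_trace (U : {vspace V}) i :
  exists2 U' : {vspace summand Vs i},
    forall x, (x \in U') = (vsval x \in U) & \dim U' = \dim (U :&: Vs i).
Proof.
pose A := [set x : summand Vs i | vsval x \in U].
have [|x y|U' memU'] := @add_closed_vspace _ A.
- by rewrite inE mem0v.
- by rewrite !inE => Ux Uy; exact: memvD.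
have {}memU' x : (x \in U') = (vsval x \in U) by rewrite memU' inE.
exists U' => //; apply/eqP; rewrite -(@eqn_exp2l 2) //.
have:= card_vspace U'; have:= card_vspace (U :&: Vs i)%VS.
rewrite !card_Fp // => <- <-.
pose val_i (x : summand Vs i) : V := vsval x.
have val_inj : injective val_i := @subvs_inj _ _ (Vs i).
rewrite -(card_imset U' val_inj); apply/eqP/eq_card => v.
apply/imsetP/idP => [[x Ux ->]|]; first by rewrite memv_cap subvsP -memU' Ux.
rewrite memv_cap => /andP[Uv Vv]; exists (vsproj (Vs i) v).
  by rewrite memU' vsprojK.
by rewrite /val_i vsprojK.
Qed.

(** As [gamma] preserves [Vs i], it sends [W :&: Vs i] injectively into
    [U :&: Vs i], so both have codimension at most [r] in [Vs i] and their
    intersection has codimension at most [2r].  That intersection is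
    invariant, because [gamma] maps [U] into [W] and [W] into [U]. *)
Lemma exchanged_vspace_trace (U W : {vspace V}) m r i :
    \dim (Vs i) = m -> (m - r <= \dim (W :&: Vs i))%N ->
    {in U, forall u, gamma u \in W} -> {in W, forall w, gamma w \in U} ->
    ~~ (Vs i <= U)%VS ->
  exists U' : {vspace summand Vs i},
    [/\ U' <> fullv, vspace_invariant (gam i) U' & (m - \dim U' <= 2 * r)%N].
Proof.
move=> dimVi dimW UW WU ViU.
have [U' memU' dimU'] := vspace_trace (U :&: W) i; exists U'; split.
- move=> U'f; case/negP: ViU; apply/subvP => v Vv.
  have := memvf (vsproj (Vs i) v); rewrite -U'f memU' vsprojK // memv_cap.
  by case/andP.
- move=> x; rewrite !memU' !memv_cap -bricklayer_summand => /andP[Ux Wx].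
  by rewrite UW ?WU.
have dimU : (\dim (W :&: Vs i) <= \dim (U :&: Vs i))%N.
  rewrite -(@leq_exp2l 2) //.
  have:= card_vspace (U :&: Vs i)%VS; have:= card_vspace (W :&: Vs i)%VS.
  rewrite !card_Fp // => <- <-.
  rewrite -(card_imset (W :&: Vs i)%VS (@perm_inj _ gamma)) subset_leq_card //.
  apply/subsetP => v; case/imsetP=> w; rewrite memv_cap => /andP[Ww Vw] ->.
  rewrite memv_cap WU //= -(vsprojK Vw) bricklayer_summand.
  exact: subvsP.
have dimUW : (\dim (U :&: Vs i + W :&: Vs i) <= m)%N.
  by rewrite -dimVi dimvS // subv_add !capvSr.
have:= dimv_sum_cap (U :&: Vs i) (W :&: Vs i).
have -> : (U :&: Vs i :&: (W :&: Vs i) = U :&: W :&: Vs i)%VS.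
  by rewrite capvA -[(U :&: Vs i :&: W)%VS]capvA [(Vs i :&: W)%VS]capvC capvA
             -[RHS]capvA -[LHS]capvA capvv capvA.
rewrite -dimU'; move: dimW dimU dimUW; lia.
Qed.

End Bricklayer.

(** * Primitivity *)

Theorem theorem5p1 (vT : vectType 'F_2) (nt m : nat)
    (Vs : 'I_nt -> {vspace finvect_type vT})
    (gam : forall i, {perm summand Vs i})
    (gamma lam : {perm finvect_type vT})
    (hV : internal_sum Vs)
    (hdim : forall i, \dim (Vs i) = m)
    (hgamma : bricklayer gam gamma)
    (hlam : linear lam)
    (h1 : gamma 0 = 0 /\ (gamma ^+ 2)%g = 1%g)
    (h2 : exists r : nat,
        [/\ (1 <= r)%N, (2 * r < m)%N &
         forall i : 'I_nt,
           (forall v : summand Vs i, v != 0 ->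
              (2 ^ (m - r - 1) < #|diff_image (gam i) v|)%N) /\
           ~ (exists U : {vspace summand Vs i},
                [/\ U <> fullv, vspace_invariant (gam i) U &
                    (m - \dim U <= 2 * r)%N])])
    (h3 : forall J : {set 'I_nt},
        (\sum_(i in J) Vs i)%VS <> 0%VS ->
        (\sum_(i in J) Vs i)%VS <> fullv ->
        ~ vspace_invariant lam (\sum_(i in J) Vs i)%VS) :
  [primitive round_group (gamma * lam)%g, on [set: finvect_type vT] | 'P].
Proof.
have [gamma0 gamma2] := h1; have [r [_ r_small hgam]] := h2.
apply/negPn/negP => /imprimitivity_subspace[U [U0 Uf rhoU]].
have lamD x y : lam (x + y) = lam x + lam y.
  by have := hlam 1 x y; rewrite !scale1r.
have lam0 : lam 0 = 0 by apply: (addrI (lam 0)); rewrite -lamD !addr0.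
have [|x y|W memW] := @add_closed_vspace _ [set w | lam w \in U].
- by rewrite inE lam0 mem0v.
- by rewrite !inE lamD; exact: memvD.
have {}memW w : (w \in W) = (lam w \in U) by rewrite memW inE.
have derW v : {in U, forall u, gamma (v + u) - gamma v \in W}.
  move=> u Uu; rewrite memW oppv_F2 lamD -[lam (gamma v)]oppv_F2 -!permM.
  exact: rhoU.
have gammaUW : {in U, forall u, gamma u \in W}.
  by move=> u Uu; have := derW 0 u Uu; rewrite add0r gamma0 subr0.
have gammaK : involutive gamma.
  by move=> x; rewrite -permM -[(gamma * gamma)%g]/(gamma ^+ 2)%g gamma2 perm1.
have gammaWU : {in W, forall w, gamma w \in U}.
  (* [lam] embeds [W] into [U], so the injection [gamma] of [U] into [W] is
     onto. *)
  have defW : gamma @: [set u in U] = [set w in W].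
    apply/eqP; rewrite eqEcard; apply/andP; split.
      by apply/subsetP => _ /imsetP[u + ->]; rewrite !inE; apply: gammaUW.
    rewrite card_imset; last exact: perm_inj.
    rewrite -(card_imset _ (@perm_inj _ lam)) subset_leq_card //.
    by apply/subsetP => _ /imsetP[w + ->]; rewrite !inE memW.
  move=> w Ww; have: w \in gamma @: [set u in U] by rewrite defW inE.
  by case/imsetP=> u + ->; rewrite inE gammaK.
have defU : U = (\sum_(i in [set i | Vs i <= U]) Vs i)%VS.
  apply: (sum_of_contained_summands hV) => c Uc i ci0.
  apply/negPn/negP => ViU; have [diff_big no_inv] := hgam i; apply: no_inv.
  apply: (exchanged_vspace_trace hV hgamma gamma0 (hdim i) _ gammaUW) => //.
  have:= leq_trans (diff_big _ ci0)
                   (card_diff_image_le hV hgamma gamma0 i derW Uc).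
  rewrite ltn_exp2l //; lia.
(* For [u] in [U], [gamma u] is again in [U] and [u = gamma (gamma u)], so [u]
   lies in [W], that is, [lam u] lies in [U]. *)
apply: (h3 [set i | Vs i <= U]%VS); rewrite -?defU // => u Uu.
rewrite -(gammaK u) -memW gammaUW //.
by move: Uu; rewrite defU; apply: bricklayer_sum_invariant.
Qed.
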